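(* Let $w=(w(n))_{n\in\mathbb{N}}$ be a bounded, strictly positive sequence such that $\mathsf{C}^{(1,w)}\in\mathcal{L}(\ell_1(w))$ and $S_w(1)\neq\emptyset$. (i) It is necessarily the case that $s_1>0$. (ii) For the dual operator $(\mathsf{C}^{(1,w)})'\in\mathcal{L}(\ell_\infty(w^{-1}))$ of $\mathsf{C}^{(1,w)}$ we have $$\left\{\lambda\in\mathbb{C}\colon\left|\lambda-\tfrac1{2s_1}\right|<\tfrac1{2s_1}\right\}\cup\Sigma\subseteq\sigma_{pt}((\mathsf{C}^{(1,w)})')$$ and $$\sigma_{pt}((\mathsf{C}^{(1,w)})')\setminus\Sigma\subseteq\left\{\lambda\in\mathbb{C}\colon\left|\lambda-\tfrac1{2s_1}\right|\le\tfrac1{2s_1}\right\}.$$ For the Cesàro operator $\mathsf{C}^{(1,w)}$ itself we have $$\left\{\lambda\in\mathbb{C}\colon\left|\lambda-\tfrac1{2s_1}\right|\le\tfrac1{2s_1}\right\}\cup\Sigma\subseteq\sigma(\mathsf{C}^{(1,w)}).$$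
   Context: The discrete Cesàro operator $\mathsf{C}\colon\mathbb{C}^{\mathbb{N}}\to\mathbb{C}^{\mathbb{N}}$ is the linear map $\mathsf{C}x:=\left(\frac{x_1+\dots+x_n}{n}\right)_{n\in\mathbb{N}}$ for $x=(x_n)_{n\in\mathbb{N}}$, with $\mathbb{N}=\{1,2,\dots\}$. For a bounded, strictly positive sequence $w$, $\ell_1(w):=\{x\in\mathbb{C}^{\mathbb{N}}\colon \sum_{n=1}^\infty w(n)|x_n|<\infty\}$, a Banach space for the norm $\|x\|_{1,w}:=\sum_{n=1}^\infty w(n)|x_n|$. Its dual space is identified with $\ell_\infty(w^{-1}):=\{y\in\mathbb{C}^{\mathbb{N}}\colon\sup_{n}w(n)^{-1}|y_n|<\infty\}$, with norm $\sup_n w(n)^{-1}|y_n|$, via the pairing $\langle x,y\rangle=\sum_n x_ny_n$. $\mathcal{L}(X)$ is the space of continuous linear operators on a Banach space $X$. Writing $\mathsf{C}^{(1,w)}\in\mathcal{L}(\ell_1(w))$ means that $\mathsf{C}$ maps $\ell_1(w)$ continuously into itself, and $\mathsf{C}^{(1,w)}$ denotes the restriction of $\mathsf{C}$ to $\ell_1(w)$; $T'$ denotes the (Banach space) dual operator of $T$. $\sigma(T)$ and $\sigma_{pt}(T)$ denote the spectrum and the set of eigenvalues of $T$. Further, $\Sigma:=\{\frac1m\colon m\in\mathbb{N}\}$, $S_w(1):=\{s\in\mathbb{R}\colon\sup_{n\in\mathbb{N}}\frac{1}{n^sw(n)}<\infty\}$ and, when $S_w(1)\neq\emptyset$, $s_1:=\inf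 S_w(1)$. *)

(* Defs.v *)
From HB Require Import structures.
From mathcomp Require Import all_boot all_order all_algebra.
From mathcomp Require Import all_classical all_reals all_analysis.
From mathcomp Require Import complex.

Set Implicit Arguments.
Unset Strict Implicit.
Unset Printing Implicit Defensive.

Import Order.TTheory GRing.Theory Num.Theory.
Import numFieldNormedType.Exports.
Import Normc.

Local Open Scope classical_set_scope.
Local Open Scope ring_scope.
Local Open Scope complex_scope.

Section Spectrum.
Variables (K : numFieldType) (X : normedModType K).

Definition point_spectrum (T : X -> X) : set K :=
  [set lambda | exists2 x : X, x != 0 & T x = lambda *: x].

(* [lambda] is in the resolvent set when [lambda - T] has a two-sided inverse
   among the continuous linear operators on [X]. *)
Definition spectrum (T : X -> X) : set K :=
  [set lambda | ~ exists S : {linear X -> X},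
    [/\ continuous S,
        cancel (fun x => lambda *: x - T x) S &
        cancel S (fun x => lambda *: x - T x)]].

End Spectrum.

Section Modulus.
Variable R : realType.
Implicit Types z : R[i].

Lemma modc_ge0 z : 0 <= normc z.
Proof. by case: z => a b; exact: sqrtr_ge0. Qed.

Lemma normCE z : `|z : R[i]^o| = (normc z)%:C.
Proof. by case: z. Qed.

Lemma lecRE (a b : R) : (a%:C <= b%:C) = (a <= b).
Proof. by rewrite lecE /= eqxx. Qed.

Lemma ltcRE (a b : R) : (a%:C < b%:C) = (a < b).
Proof. by rewrite ltcE /= eqxx. Qed.

Lemma gt0_complexE (e : R[i]) : 0 < e -> exists2 r : R, 0 < r & e = r%:C.
Proof. by case: e => a b; rewrite ltcE /= => /andP[/eqP -> a0]; exists a. Qed.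

Lemma real_complex_continuous : continuous (fun a : R => a%:C : R[i]^o).
Proof.
move=> a; apply/cvgrPdist_lt => e /gt0_complexE[r r0 ->].
near=> b; rewrite -rmorphB normCE ltcRE /= expr0n /= addr0 sqrtr_sqr.
by near: b; exact: cvgr_dist_lt.
Unshelve. all: by end_near. Qed.

Lemma cvgn_complex (a b : nat -> R) : cvgn a -> cvgn b ->
  cvgn (fun n => (a n +i* b n) : R[i]^o).
Proof.
move=> /cvg_ex[/= la ala] /cvg_ex[/= lb blb].
rewrite (_ : (fun n => _) = fun n =>
  ((a n)%:C : R[i]^o) + ('i : R[i]^o) * (b n)%:C); last first.
  apply/funext => n; apply/eqP; rewrite eq_complex /=.
  by rewrite !mul0r mulr0 !mul1r !subr0 ?addr0 ?add0r !eqxx.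
apply: is_cvgD.
  by apply/cvg_ex; exists (la%:C); apply: continuous_cvg => //;
    exact: real_complex_continuous.
apply: is_cvgMl_tmp; apply/cvg_ex; exists (lb%:C); apply: continuous_cvg => //.
exact: real_complex_continuous.
Qed.

Lemma abs_cvgn_series (u : nat -> R[i]^o) (M : R) :
  (forall n, \sum_(0 <= k < n) normc (u k) <= M) -> cvgn (series u).
Proof.
move=> uM.
have real_cvg (a : nat -> R) : (forall k, `|a k| <= normc (u k)) ->
    cvgn (series a).
  move=> au; apply: normed_cvg; apply: nondecreasing_is_cvgn.
    apply: nondecreasing_series => n _ _; exact: normr_ge0.
  exists M => _ [n _ <-]; rewrite /series /=.
  by apply: le_trans (uM n); apply: ler_sum.
have le_normc (c d : R) : `|c| <= normc (c +i* d) /\ `|d| <= normc (c +i* d).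
  by rewrite -!sqrtr_sqr !ler_sqrt ?lerDl ?lerDr ?addr_ge0 ?sqr_ge0.
have := @cvgn_complex (series (fun k => complex.Re (u k)))
  (series (fun k => complex.Im (u k))).
rewrite (_ : (fun n => _) = series u); first apply.
- by apply: real_cvg => k; case: (u k) => c d; case: (le_normc c d).
- by apply: real_cvg => k; case: (u k) => c d; case: (le_normc c d).
apply/funext; elim => [|n ih]; first by rewrite /series /= !big_geq.
by rewrite !seriesSr -ih; case: (u n).
Qed.

Lemma normc_lim_le (u : nat -> R[i]^o) (l : R[i]^o) (M : R) : u @ \oo --> l ->
  (forall n, normc (u n) <= M) -> normc l <= M.
Proof.
move=> /cvgrPdist_lt ul uM; rewrite leNgt; apply/negP => Ml.
have e0 : 0 < (normc l - M)%:C by rewrite (ltcRE 0) subr_gt0.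
have [N _ /(_ N (leqnn N))] := ul _ e0.
rewrite normCE ltcRE ltNge => /negP; apply.
have := le_normcD (l - u N) (u N); rewrite subrK => lu.
by rewrite lerBlDr (le_trans lu)// lerD.
Qed.

End Modulus.

Section WeightedL1.
Variables (R : realType) (w : nat -> {posnum R}).
Implicit Types x y : nat -> R[i]^o.

Definition l1_enorm x : \bar R :=
  \sum_(0 <= n <oo) ((w n)%:num * normc (x n))%:E.

Definition l1_pred : {pred nat -> R[i]^o} :=
  mem [set x | (l1_enorm x < +oo)%E].

Lemma l1_term_ge0 x n : (0 <= ((w n)%:num * normc (x n))%:E)%E.
Proof. by rewrite lee_fin mulr_ge0 ?modc_ge0. Qed.
Hint Resolve l1_term_ge0 : core.

Lemma l1_enorm_ge0 x : (0 <= l1_enorm x)%E.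
Proof. exact: nneseries_ge0. Qed.

Lemma l1_enormZ a x : l1_enorm (a *: x) = ((normc a)%:E * l1_enorm x)%E.
Proof.
rewrite /l1_enorm -nneseriesZl//; apply: eq_eseriesr => n _.
by rewrite -EFinM mulrCA -normcM.
Qed.

Lemma l1_enormD x y : (l1_enorm (x + y)%R <= l1_enorm x + l1_enorm y)%E.
Proof.
rewrite /l1_enorm -nneseriesD//; apply: lee_nneseries => // n _.
by rewrite -EFinD lee_fin -mulrDr ler_wpM2l// le_normcD.
Qed.

Lemma l1_enorm_term x n : (((w n)%:num * normc (x n))%:E <= l1_enorm x)%E.
Proof. by rewrite /l1_enorm (nneseriesD1 (n := n))// leeDl// nneseries_ge0. Qed.

Lemma l1_submod_closed : submod_closed l1_pred.
Proof.
split=> [|a x y]; rewrite !inE/= /l1_enorm.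
  rewrite eseries0// => n _ _; congr EFin.
  by rewrite [normc _](normc0 R) mulr0.
move=> xoo yoo; apply: le_lt_trans (l1_enormD _ _) _.
by rewrite l1_enormZ lte_add_pinfty// lte_mul_pinfty// ?lee_fin ?modc_ge0.
Qed.

HB.instance Definition _ := GRing.isSubmodClosed.Build _ _ l1_pred
  l1_submod_closed.

Record l1 := L1 { l1_val :> nat -> R[i]^o ; l1_valP : l1_val \in l1_pred }.

HB.instance Definition _ := [isSub for l1_val].
HB.instance Definition _ := [Choice of l1 by <:].
HB.instance Definition _ := [SubChoice_isSubLmodule of l1 by <:].

(* A [normedModType] over [R[i]] has its norm valued in [R[i]]. *)
Definition l1_norm (x : l1) : R[i] := (fine (l1_enorm x))%:C.

Lemma l1_enorm_fin (x : l1) : l1_enorm x \is a fin_num.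
Proof. by rewrite ge0_fin_numE ?l1_enorm_ge0//; have := l1_valP x; rewrite inE. Qed.

Let l1_normD (x y : l1) : l1_norm (x + y) <= l1_norm x + l1_norm y.
Proof.
rewrite /l1_norm -rmorphD /= lecRE -lee_fin EFinD.
by rewrite !fineK ?(l1_enorm_fin x, l1_enorm_fin y, l1_enorm_fin (x + y))// l1_enormD.
Qed.

Let l1_normZ (a : R[i]) (x : l1) : l1_norm (a *: x) = `|a| * l1_norm x.
Proof.
rewrite /l1_norm normCE -rmorphM /=; congr (_%:C).
by rewrite l1_enormZ fineM ?l1_enorm_fin.
Qed.

Let l1_norm_eq0 (x : l1) : l1_norm x = 0 -> x = 0.
Proof.
case=> x0; apply/val_inj/funext => n /=; apply: eq0_normc.
have := l1_enorm_term x n.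
rewrite -(fineK (l1_enorm_fin x)) x0 lee_fin pmulr_rle0// => xn0.
by apply/eqP; rewrite eq_le xn0 modc_ge0.
Qed.

HB.instance Definition _ :=
  Lmodule_isNormed.Build R[i] l1 l1_normD l1_normZ l1_norm_eq0.

End WeightedL1.

Section WeightedLinf.
Variables (R : realType) (v : nat -> {posnum R}).
Implicit Types x y : nat -> R[i]^o.

Definition linf_range x : set R := range (fun n => (v n)%:num * normc (x n)).

Definition linf_pred : {pred nat -> R[i]^o} :=
  mem [set x | has_ubound (linf_range x)].

Lemma linf_submod_closed : submod_closed linf_pred.
Proof.
split=> [|a x y]; rewrite !inE/=.
  by exists 0 => _ [n _ <-]; rewrite [normc _](normc0 R) mulr0.
move=> [A Ax] [B By]; exists (normc a * A + B) => _ [n _ <-].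
have := le_normcD (a * x n) (y n).
move=> /(ler_wpM2l (ge0 (v n))) /le_trans; apply.
rewrite mulrDr lerD//; last by apply: By; exists n.
rewrite normcM mulrCA ler_wpM2l ?modc_ge0//; apply: Ax; by exists n.
Qed.

HB.instance Definition _ := GRing.isSubmodClosed.Build _ _ linf_pred
  linf_submod_closed.

Record linf := Linf {
  linf_val :> nat -> R[i]^o ; linf_valP : linf_val \in linf_pred }.

HB.instance Definition _ := [isSub for linf_val].
HB.instance Definition _ := [Choice of linf by <:].
HB.instance Definition _ := [SubChoice_isSubLmodule of linf by <:].

Definition linf_norm (x : linf) : R[i] := (sup (linf_range x))%:C.

Lemma linf_term (x : linf) n : (v n)%:num * normc (x n) <= sup (linf_range x).
Proof.
apply: ub_le_sup; last by exists n.
by have := linf_valP x; rewrite inE.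
Qed.

Lemma linf_norm_le (x : linf) M :
  (forall n, (v n)%:num * normc (x n) <= M) -> sup (linf_range x) <= M.
Proof.
move=> xM; apply: ge_sup => [|_ [n _ <-]//].
by exists ((v 0)%:num * normc (x 0)), 0%N.
Qed.

Let linf_normD (x y : linf) : linf_norm (x + y) <= linf_norm x + linf_norm y.
Proof.
rewrite /linf_norm -rmorphD lecRE; apply: (@linf_norm_le (x + y)) => n.
apply: le_trans (lerD (linf_term x n) (linf_term y n)).
by rewrite -mulrDr ler_wpM2l// le_normcD.
Qed.

Let linf_normZ (a : R[i]) (x : linf) : linf_norm (a *: x) = `|a| * linf_norm x.
Proof.
rewrite /linf_norm normCE -rmorphM /=; congr (_%:C).
have leZ b (z : linf) :
    sup (linf_range (b *: z)) <= normc b * sup (linf_range z).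
  apply: linf_norm_le => n.
  by rewrite normcM mulrCA ler_wpM2l ?modc_ge0// linf_term.
apply/eqP; rewrite eq_le leZ/=.
have [->|a0] := eqVneq a 0.
  rewrite normc0 mul0r; apply: le_trans (linf_term (0 *: x) 0%N).
  by rewrite mulr_ge0 ?modc_ge0.
have na0 : 0 < normc a.
  rewrite lt_neqAle modc_ge0 andbT eq_sym.
  by apply: contra a0 => /eqP/eq0_normc ->.
rewrite -ler_pdivlMl// -normcV.
by have := leZ a^-1 (a *: x); rewrite scalerA mulVf// scale1r.
Qed.

Let linf_norm_eq0 (x : linf) : linf_norm x = 0 -> x = 0.
Proof.
case=> x0; apply/val_inj/funext => n /=; apply: eq0_normc.
have := linf_term x n; rewrite x0 pmulr_rle0// => xn0.
by apply/eqP; rewrite eq_le xn0 modc_ge0.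
Qed.

HB.instance Definition _ :=
  Lmodule_isNormed.Build R[i] linf linf_normD linf_normZ linf_norm_eq0.

End WeightedLinf.

Section Duality.
Variables (R : realType) (w : nat -> {posnum R}).

Definition inv_weight : nat -> {posnum R} := fun n => ((w n)%:num^-1)%:pos.

Definition pairing (x : l1 w) (y : linf inv_weight) : R[i]^o :=
  limn (series (fun n => x n * y n : R[i]^o)).

(* The dual space of [l1 w] is identified with [linf inv_weight] through
   [pairing]; the default [0] of [xget] is never used for a continuous linear
   [T], see [dual_operatorP]. *)
Definition dual_operator (T : l1 w -> l1 w) (y : linf inv_weight) :
    linf inv_weight :=
  xget 0 [set z | forall x, pairing x z = pairing (T x) y].

Lemma l1_normE (x : l1 w) : `|x| = (fine (l1_enorm w x))%:C.
Proof. by []. Qed.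

Lemma linf_normE (y : linf inv_weight) : `|y| = (sup (linf_range inv_weight y))%:C.
Proof. by []. Qed.

Lemma pairing_sum_le (x : l1 w) (y : linf inv_weight) n :
  \sum_(0 <= k < n) normc (x k * y k) <=
  fine (l1_enorm w x) * sup (linf_range inv_weight y).
Proof.
apply: (@le_trans _ _ ((\sum_(0 <= k < n) (w k)%:num * normc (x k)) *
    sup (linf_range inv_weight y))).
  rewrite mulr_suml; apply: ler_sum => k _.
  have := linf_term y k; rewrite /= ler_pdivrMl// => yk.
  by rewrite normcM [X in _ <= X * _]mulrC -mulrA ler_wpM2l ?modc_ge0.
rewrite ler_wpM2r//.
  by apply: le_trans (linf_term y 0%N); rewrite mulr_ge0 ?modc_ge0.
rewrite -lee_fin fineK ?l1_enorm_fin// -sumEFin.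
by apply: nneseries_lim_ge => k _ _; exact: l1_term_ge0.
Qed.

Lemma pairing_cvg (x : l1 w) (y : linf inv_weight) :
  series (fun n => x n * y n : R[i]^o) @ \oo --> pairing x y.
Proof. exact: abs_cvgn_series (pairing_sum_le x y). Qed.
Arguments pairing_cvg : clear implicits.

Lemma pairing_le (x : l1 w) (y : linf inv_weight) :
  normc (pairing x y) <= fine (l1_enorm w x) * sup (linf_range inv_weight y).
Proof.
apply: normc_lim_le (pairing_cvg x y) _ => n.
apply: le_trans (pairing_sum_le x y n); rewrite /series /=.
elim: n => [|n ih]; first by rewrite !big_geq// normc0.
by rewrite !big_nat_recr//= (le_trans (le_normcD _ _))// lerD.
Qed.

Let pairingr y x := pairing x y.

Lemma pairing_linearl (y : linf inv_weight) : linear (pairingr y).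
Proof.
move=> a x x'; rewrite /pairingr; apply: cvg_lim => //.
pose f := series (fun n => x n * y n : R[i]^o).
rewrite (_ : series _ = (a \*: f) + series (fun n => x' n * y n : R[i]^o)).
  exact: cvgD (cvgZl_tmp (pairing_cvg x y)) (pairing_cvg x' y).
apply/funext => n; rewrite /f /series -[RHS]/(a * _ + _) /= mulr_sumr -big_split /=.
by apply: eq_bigr => k _; rewrite mulrDl mulrA.
Qed.

HB.instance Definition _ y :=
  GRing.isLinear.Build R[i] (l1 w) R[i]^o _ (pairingr y)
    (pairing_linearl y).

Lemma pairing_linearr (x : l1 w) : linear (pairing x).
Proof.
move=> a y y'; apply: cvg_lim => //.
pose f := series (fun n => x n * y n : R[i]^o).
rewrite (_ : series _ = (a \*: f) + series (fun n => x n * y' n : R[i]^o)).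
  exact: cvgD (cvgZl_tmp (pairing_cvg x y)) (pairing_cvg x y').
apply/funext => n; rewrite /f /series -[RHS]/(a * _ + _) /= mulr_sumr -big_split /=.
by apply: eq_bigr => k _; rewrite mulrDr mulrCA.
Qed.

Lemma l1_basis_subproof n :
  (fun k => (k == n)%:R : R[i]^o) \in l1_pred w.
Proof.
rewrite inE /= /l1_enorm (nneseriesD1 (n := n))//; last first.
  by move=> k _; rewrite lee_fin mulr_ge0 ?modc_ge0.
rewrite eseries0 ?adde0 ?ltry// => k _ /negbTE kn; rewrite kn.
by rewrite [normc _](normc0 R) mulr0.
Qed.

Definition l1_basis n : l1 w := L1 (l1_basis_subproof n).

Lemma l1_basis_norm n : l1_enorm w (l1_basis n) = (w n)%:num%:E.
Proof.
rewrite /l1_enorm (nneseriesD1 (n := n))//=; last first.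
  by move=> k _; rewrite lee_fin mulr_ge0 ?modc_ge0.
rewrite eqxx [normc _](normc1 R) mulr1.
rewrite eseries0 ?adde0// => k _ /negbTE kn; rewrite kn.
by rewrite [normc _](normc0 R) mulr0.
Qed.

Lemma pairing_basis n (y : linf inv_weight) : pairing (l1_basis n) y = y n.
Proof.
apply: cvg_lim => //; apply: cvg_near_cst; exists n.+1 => //= m /= nm.
rewrite /series /= big_mkord (bigD1 (Ordinal nm))//= eqxx mul1r big1 ?addr0//.
by move=> k /negbTE kn; rewrite (_ : (val k == n) = false) ?mul0r.
Qed.

Definition l1_trunc (x : l1 w) N : l1 w := \sum_(0 <= k < N) x k *: l1_basis k.

Lemma l1_truncE (x : l1 w) N k : l1_trunc x N k = if (k < N)%N then x k else 0.
Proof.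
elim: N => [|N ih]; first by rewrite /l1_trunc big_geq.
rewrite /l1_trunc big_nat_recr//=.
rewrite -[LHS]/(l1_trunc x N k + x N * (k == N)%:R) ih.
have [->|kN] := eqVneq k N; first by rewrite ltnn ltnSn add0r mulr1.
by rewrite mulr0 addr0 ltnS [in RHS]leq_eqVlt (negbTE kN).
Qed.

Lemma l1_trunc_cvg (x : l1 w) : l1_trunc x @ \oo --> x.
Proof.
apply/cvgrPdist_lt => e /gt0_complexE[r r0 ->].
have xoo : (l1_enorm w x < +oo)%E by have := l1_valP x; rewrite inE.
have := nneseries_tail_cvg xoo (fun k _ => l1_term_ge0 w x k).
have r0' : (0 < r%:E)%E by rewrite lte_fin.
move=> /(_ _ (open_ereal_lt' r0'))[M _ xM].
exists M => // N /= /xM /= xN; rewrite l1_normE ltcRE -lte_fin fineK ?l1_enorm_fin//.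
apply: le_lt_trans xN.
rewrite /l1_enorm (nneseries_split 0%N N); last first.
  by move=> k _; rewrite lee_fin mulr_ge0 ?modc_ge0.
rewrite big1_seq ?add0e ?add0n.
  apply: lee_nneseries => [k _ _|k _].
    by rewrite lee_fin mulr_ge0 ?modc_ge0.
  rewrite -[(x - _) k]/(x k - l1_trunc x N k) l1_truncE.
  case: ifP => _; last by rewrite subr0.
  by rewrite subrr [normc _](normc0 R) mulr0 lee_fin mulr_ge0 ?modc_ge0.
move=> k /andP[_]; rewrite mem_index_iota => /andP[_ kN].
rewrite -[(x - _) k]/(x k - l1_trunc x N k) l1_truncE kN subrr.
by rewrite [normc _](normc0 R) mulr0.
Qed.

Lemma l1_bounded (T : {linear l1 w -> l1 w}) : continuous T ->
  exists2 r : R, 0 <= r &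
    forall x, fine (l1_enorm w (T x)) <= r * fine (l1_enorm w x).
Proof.
move=> /(_ 0)/continuous_linear_bounded/linear_boundedP.
move=> /pinfty_ex_gt0[_ /gt0_complexE[r r0 ->] rT].
exists r; first exact: ltW.
by move=> x; have := rT x; rewrite !l1_normE -rmorphM lecRE.
Qed.

Lemma dual_operator_subproof (T : {linear l1 w -> l1 w})
    (y : linf inv_weight) r : 0 <= r ->
    (forall x, fine (l1_enorm w (T x)) <= r * fine (l1_enorm w x)) -> forall n,
  (inv_weight n)%:num * normc (pairing (T (l1_basis n)) y) <=
  r * sup (linf_range inv_weight y).
Proof.
move=> r0 rT n; rewrite /= ler_pdivrMl//.
apply: le_trans (pairing_le _ _) _; rewrite mulrA ler_wpM2r//.
  by apply: le_trans (linf_term y 0%N); rewrite mulr_ge0 ?modc_ge0.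
by have := rT (l1_basis n); rewrite l1_basis_norm /= mulrC.
Qed.

Lemma pairing_continuous (y : linf inv_weight) :
  continuous (fun x : l1 w => pairing x y).
Proof.
apply: (@bounded_linear_continuous _ _ _ (pairingr y)).
apply/linear_boundedP; near=> M => x.
rewrite normCE l1_normE; apply: (@le_trans _ _
  ((sup (linf_range inv_weight y))%:C * (fine (l1_enorm w x))%:C)).
  by rewrite -rmorphM lecRE mulrC pairing_le.
rewrite ler_wpM2r//; first by rewrite (lecRE 0) fine_ge0// l1_enorm_ge0.
near: M; apply: nbhs_pinfty_ge; rewrite realE (lecRE 0).
rewrite (le_trans _ (linf_term y 0%N))//.
by rewrite mulr_ge0 ?modc_ge0.
Unshelve. all: by end_near. Qed.

Lemma dual_operatorP (T : {linear l1 w -> l1 w}) : continuous T ->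
  forall x y, pairing x (dual_operator T y) = pairing (T x) y.
Proof.
move=> Tc x y; have [r r0 rT] := l1_bounded Tc.
have zP : (fun n => pairing (T (l1_basis n)) y) \in linf_pred inv_weight.
  rewrite inE; exists (r * sup (linf_range inv_weight y)) => _ [n _ <-].
  exact: dual_operator_subproof.
rewrite /dual_operator; move: x.
case: xgetP => [_ -> //|/(_ (Linf zP))]; case=> x.
apply: cvg_lim => //.
rewrite (_ : series _ = fun N => pairing (T (l1_trunc x N)) y).
  have TN : T (l1_trunc x N) @[N --> \oo] --> T x.
    by apply: continuous_cvg; [exact: Tc|exact: l1_trunc_cvg].
  have pc := @pairing_continuous y (T x).
  exact: (cvg_comp _ _ TN pc).
apply/funext => N; rewrite /series /l1_trunc /= raddf_sum /=.
rewrite -[RHS]/(pairingr y _) raddf_sum /=.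
by apply: eq_bigr => k _; rewrite linearZ /= linearZ.
Qed.

Lemma dual_operator_basis (T : {linear l1 w -> l1 w}) y n : continuous T ->
  dual_operator T y n = pairing (T (l1_basis n)) y.
Proof. by move=> Tc; rewrite -pairing_basis dual_operatorP. Qed.

Lemma dual_operator_linear (T : {linear l1 w -> l1 w}) : continuous T ->
  linear (dual_operator T).
Proof.
move=> Tc a y y'; apply/val_inj/funext => n /=.
rewrite -[RHS]/(a * dual_operator T y n + dual_operator T y' n).
by rewrite !dual_operator_basis// pairing_linearr.
Qed.

Lemma dual_operator_continuous (T : {linear l1 w -> l1 w}) : continuous T ->
  continuous (dual_operator T).
Proof.
move=> Tc; have [r r0 rT] := l1_bounded Tc.
pose L := GRing.isLinear.Build R[i] (linf inv_weight) (linf inv_weight) _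
  (dual_operator T) (dual_operator_linear Tc).
pose T' : {linear linf inv_weight -> linf inv_weight} :=
  HB.pack (dual_operator T) L.
apply: (@bounded_linear_continuous _ _ _ T').
apply/linear_boundedP; near=> M => y.
rewrite !linf_normE; apply: (@le_trans _ _
  (r%:C * (sup (linf_range inv_weight y))%:C)).
  rewrite -rmorphM lecRE; apply: linf_norm_le => n.
  by rewrite dual_operator_basis//; exact: dual_operator_subproof.
rewrite ler_wpM2r//.
  rewrite (lecRE 0) (le_trans _ (linf_term y 0%N))//.
  by rewrite mulr_ge0 ?modc_ge0.
by near: M; apply: nbhs_pinfty_ge; rewrite realE (lecRE 0) r0.
Unshelve. all: by end_near. Qed.

End Duality.

Section Cesaro.
Variable R : realType.

(* Sequences are indexed from [0]: the entry [x n] is the usual [x_(n+1)]. *)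
Definition cesaro_operator (x : nat -> R[i]^o) : nat -> R[i]^o :=
  fun n => (\sum_(k < n.+1) x k) / n.+1%:R.

Definition reciprocals : set R[i] := range (fun m => m.+1%:R^-1).

Definition S1 (w : nat -> {posnum R}) : set R :=
  [set s | has_ubound (range (fun n => (n.+1%:R `^ s * (w n)%:num)^-1))].

Definition s1 (w : nat -> {posnum R}) : R := inf (S1 w).

End Cesaro.

Arguments reciprocals : clear implicits.

(* Main.v *)
(* C' y = lambda y forces y(n+1) = (1 - 1/(lambda n)) y(n), so y is a product
   with |y(n)| comparable to n^(-Re(1/lambda)), unless 1/lambda is a positive
   integer, when y has finite support. Hence y lies in l_infty(w^-1) when
   Re(1/lambda) > s1, and only if Re(1/lambda) belongs to S_w(1). Since
   eigenvalues of C' are bounded by the operator norm, every 1/t with t above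
   some s in S_w(1) is bounded, which gives s1 > 0. If S inverts lambda - T,
   then S' y = y/(lambda - mu) for each eigenpair (mu, y) of T', so the
   eigenvalues of T' stay at distance at least 1/|S| from lambda; this handles
   the boundary of the disc without completeness of l_1(w). *)

Require Import Defs.
From mathcomp Require Import all_boot all_order all_algebra.
From mathcomp Require Import all_classical all_reals all_analysis.
From mathcomp Require Import complex.
From mathcomp Require Import ring lra.

Set Implicit Arguments.
Unset Strict Implicit.
Unset Printing Implicit Defensive.

Import Order.TTheory GRing.Theory Num.Theory.
Import numFieldNormedType.Exports.
Import Normc.

Local Open Scope classical_set_scope.
Local Open Scope ring_scope.
Local Open Scope complex_scope.

(** * Power-law bounds for products with factors 1 - c/n + O(1/n^2) *)

Section HarmonicProducts.
Variable R : realType.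
Implicit Types (p q : nat -> R) (a b c : R).

Definition harmonic2 (n : nat) : R := harmonic n ^+ 2.

Lemma harmonic_gt0 n : 0 < harmonic n :> R.
Proof. by rewrite /= invr_gt0 ltr0n. Qed.

Lemma harmonic_le1 n : harmonic n <= 1 :> R.
Proof. by rewrite /= invf_le1 ?ler1n ?ltr0n. Qed.

Lemma harmonicS n : harmonic n.+1 = harmonic n / (1 + harmonic n) :> R.
Proof.
have x0 : 0 < n.+1%:R :> R by rewrite ltr0n.
rewrite /= -[n.+2%:R]natr1; set x : R := n.+1%:R in x0 *.
by field; rewrite !gt_eqF// addr_gt0.
Qed.

Lemma lnS n : ln n.+2%:R = ln n.+1%:R + ln (1 + harmonic n) :> R.
Proof.
rewrite -lnM ?posrE ?ltr0n ?addr_gt0 ?harmonic_gt0//; congr ln.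
by rewrite mulrDr mulr1 divff ?pnatr_eq0// natr1.
Qed.

Lemma ln_le_series_harmonic n : ln n.+1%:R <= series harmonic n :> R.
Proof.
elim: n => [|n ih]; first by rewrite ln1 /series /= big_geq.
rewrite lnS seriesSr lerD// le_ln1Dx//.
by rewrite (lt_trans _ (harmonic_gt0 n)) ?ltrN10.
Qed.

Lemma series_harmonicS_le n : series harmonic n.+1 <= 1 + ln n.+1%:R :> R.
Proof.
elim: n => [|n ih]; first by rewrite ln1 /series /= big_nat1 invr1 addr0.
rewrite seriesSr lnS addrA lerD// harmonicS.
have h0 := harmonic_gt0 n; set h : R := harmonic n in h0 *.
(* The inequality [ln (1 + x) <= x] is applied to 1/(1 + h) = 1 - h/(1 + h). *)
rewrite -lerN2 -lnV ?posrE ?addr_gt0//.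
rewrite [X in ln X](_ : _ = 1 + (- (h / (1 + h)))).
  by rewrite le_ln1Dx// ltrN2 ltr_pdivrMr ?addr_gt0// mul1r ltrDr.
by field; rewrite gt_eqF// addr_gt0.
Qed.

Lemma series_harmonic_le n : series harmonic n <= 1 + ln n.+1%:R :> R.
Proof.
apply: le_trans (series_harmonicS_le n).
by rewrite seriesSr lerDl ltW// harmonic_gt0.
Qed.

Lemma series_harmonic2_le n : series harmonic2 n <= 2.
Proof.
(* The sharper bound 2 - 1/(k+1) is inductive, since 1/(k+2)^2 <= 1/(k+1) - 1/(k+2). *)
suff H k : series harmonic2 k.+1 <= 2 - harmonic k :> R.
  case: n => [|n]; first by rewrite /series /= big_geq.
  by apply: le_trans (H n) _; rewrite gerBl ltW// harmonic_gt0.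
elim: k => [|k ih].
  by rewrite seriesSr /series /= big_geq// add0r /harmonic2 /= invr1; lra.
rewrite seriesSr /harmonic2; apply: le_trans (lerD ih (lexx _)) _.
rewrite harmonicS; have h0 := harmonic_gt0 k; set h : R := harmonic k in h0 *.
rewrite -subr_ge0 (_ : _ - _ = h ^+ 3 / (1 + h) ^+ 2).
  by rewrite divr_ge0 ?exprn_ge0 ?addr_ge0// ltW.
by field; rewrite gt_eqF// addr_gt0.
Qed.

Lemma powR_natE n c : n.+1%:R `^ c = expR (c * ln n.+1%:R) :> R.
Proof. by rewrite /powR pnatr_eq0. Qed.

(** The error is measured by [|c|] because [c], later twice a real part, may have either sign. *)
Lemma mul_series_harmonic c n :
  `|c * series harmonic n - c * ln n.+1%:R| <= `|c|.
Proof.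
rewrite -mulrBr normrM ler_piMr// ler_norml.
have := ln_le_series_harmonic n; have := series_harmonic_le n.
by move: (series _ _) (ln _) => u v; lra.
Qed.

(** Iteration sums the exponents: the squared harmonic series stays below 2, and the harmonic series
    is a logarithm up to a bounded error, which produces the power of n + 1. *)
Lemma harmonic_prod_le q b c : 0 <= b -> 0 <= q 0 ->
  (forall n, q n.+1 <= q n * expR (b * harmonic2 n - c * harmonic n)) ->
  exists2 K, 0 <= K & forall n, q n <= K * n.+1%:R `^ (- c).
Proof.
move=> b0 q0 qS.
have H n : q n <= q 0 * expR (b * series harmonic2 n - c * series harmonic n).
  elim: n => [|n ih].
    by rewrite /series /= !big_geq// !mulr0 subrr expR0 mulr1.
  apply: le_trans (qS n) _; apply: le_trans (ler_wpM2r (expR_ge0 _) ih) _.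
  rewrite -mulrA -expRD !seriesSr ler_wpM2l// ler_expR le_eqVlt.
  by apply/orP; left; apply/eqP; ring.
exists (q 0 * expR (b * 2 + `|c|)) => [|n].
  by rewrite mulr_ge0 ?expR_ge0.
apply: le_trans (H n) _; rewrite powR_natE -mulrA -expRD.
rewrite ler_wpM2l// ler_expR.
have := mul_series_harmonic c n; rewrite ler_norml => /andP[h _].
have := ler_wpM2l b0 (series_harmonic2_le n).
by move: h; rewrite mulNr; lra.
Qed.

(** The first N terms, where no ratio estimate is available, are positive and finite in number, so
    they only lower the constant. *)
Lemma eventually_nondecreasing_bound p N : (forall n, 0 < p n) ->
  (forall n, (N <= n)%N -> p n <= p n.+1) ->
  exists2 K, 0 < K & forall n, K <= p n.
Proof.
elim: N p => [|N ih] p p0 pS.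
  by exists (p 0) => //; elim=> // n /le_trans; apply; exact: pS.
have [n||K K0 pK] := ih (fun n => p n.+1); first exact: p0.
  by move=> n Nn; exact: pS.
exists (Num.min (p 0) K) => [|[|n]]; first by rewrite lt_min p0.
  by rewrite ge_min lexx.
by rewrite ge_min pK orbT.
Qed.

Lemma harmonic_prod_ge q b c N : 0 <= b -> (forall n, 0 < q n) ->
  (forall n, (N <= n)%N ->
    q n * expR (- (b * harmonic2 n) - c * harmonic n) <= q n.+1) ->
  exists2 K, 0 < K & forall n, K * n.+1%:R `^ (- c) <= q n.
Proof.
move=> b0 q0 qS.
(* Dividing [q] by its expected decay gives a sequence that is nondecreasing from [N] on. *)
pose p n := q n * expR (b * series harmonic2 n + c * series harmonic n).
have [n|n Nn|K K0 pK] := @eventually_nondecreasing_bound p N.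
- by rewrite mulr_gt0 ?expR_gt0.
- apply: le_trans (ler_wpM2r (expR_ge0 _) (qS n Nn)).
  rewrite -mulrA -expRD !seriesSr ler_wpM2l ?(ltW (q0 n))// ler_expR le_eqVlt.
  by apply/orP; left; apply/eqP; ring.
exists (K * expR (- (b * 2) - `|c|)) => [|n].
  by rewrite mulr_gt0 ?expR_gt0.
rewrite -(ler_pM2r (expR_gt0 (b * series harmonic2 n + c * series harmonic n))).
apply: le_trans (pK n); rewrite powR_natE -!mulrA -!expRD.
rewrite ger_pMr// -[leRHS]expR0 ler_expR.
have := mul_series_harmonic c n; rewrite ler_norml => /andP[_ h].
have := ler_wpM2l b0 (series_harmonic2_le n).
by move: h; rewrite mulNr; lra.
Qed.

(** From exp(-v) <= 1/(1 + v) with v = 2u^2 - u, it remains to see that (1 + u)(1 - u + 2u^2) = 1 +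
    u^2(1 + 2u) is at least 1. *)
Lemma expR_sub_sqr_le (u : R) : - 2^-1 <= u -> expR (u - 2 * u ^+ 2) <= 1 + u.
Proof.
move=> u2; rewrite -[_ - _]opprK expRN.
apply: (@le_trans _ _ (1 - (u - 2 * u ^+ 2))^-1).
  have v0 : 0 < 1 - (u - 2 * u ^+ 2) by nra.
  rewrite lef_pV2 ?posrE ?expR_gt0//; exact: expR_ge1Dx.
have v0 : 0 < 1 - (u - 2 * u ^+ 2) by nra.
rewrite -[leLHS]mul1r ler_pdivrMr//.
have : 0 <= u ^+ 2 * (1 + 2 * u) by rewrite mulr_ge0 ?sqr_ge0//; lra.
by rewrite expr2; lra.
Qed.

Lemma quadratic_prod_le q a b : 0 <= b -> (forall n, 0 <= q n) ->
  (forall n, q n.+1 = q n * (1 - 2 * a * harmonic n + b * harmonic2 n)) ->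
  exists2 K, 0 <= K & forall n, q n <= K * n.+1%:R `^ (- (2 * a)).
Proof.
move=> b0 q0 qS; apply: (harmonic_prod_le b0 (q0 0)) => n.
rewrite qS ler_wpM2l//; apply: le_trans (expR_ge1Dx _).
by rewrite -addrA lerD2l addrC.
Qed.

Lemma quadratic_prod_ge q a b : 0 <= b -> (forall n, 0 < q n) ->
  (forall n, q n.+1 = q n * (1 - 2 * a * harmonic n + b * harmonic2 n)) ->
  exists2 K, 0 < K & forall n, K * n.+1%:R `^ (- (2 * a)) <= q n.
Proof.
(* Each factor is 1 + u with |u| <= d/(n+1). From [truncn (2 * d)] on this is at most 1/2, so
   [expR_sub_sqr_le] applies, with 2u^2 <= 2d^2/(n+1)^2. *)
move=> b0 q0 qS; pose d := 2 * `|a| + b.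
have d0 : 0 <= d by rewrite addr_ge0 ?mulr_ge0.
have dsq : 0 <= 2 * d ^+ 2 by rewrite mulr_ge0 ?sqr_ge0.
apply: (harmonic_prod_ge (N := Num.truncn (2 * d)) dsq q0) => n Nn.
have h0 := harmonic_gt0 n; have h1 := harmonic_le1 n.
rewrite qS ler_wpM2l ?(ltW (q0 n))//.
have dh : d * harmonic n <= 2^-1.
  have : 2 * d < n.+1%:R.
    by apply: lt_le_trans (truncnS_gt _) _; rewrite ler_nat.
  by rewrite /= ler_pdivrMr ?ltr0n//; lra.
rewrite /harmonic2; set h : R := harmonic n in h0 h1 dh *.
set u := b * h ^+ 2 - 2 * a * h.
have ud : `|u| <= d * h.
  apply: le_trans (ler_normB _ _) _.
  have bh0 : 0 <= b * h ^+ 2 by rewrite mulr_ge0 ?sqr_ge0.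
  rewrite (ger0_norm bh0) -mulrA normrM (@ger0_norm _ 2)// normrM (gtr0_norm h0).
  have : b * h ^+ 2 <= b * h by rewrite ler_wpM2l// expr2 ler_piMl// ltW.
  by rewrite /d; lra.
have u2 : u ^+ 2 <= (d * h) ^+ 2.
  by rewrite -[leLHS]real_normK ?num_real// ler_sqr ?nnegrE ?mulr_ge0// ltW.
have := @expR_sub_sqr_le u; rewrite (_ : 1 - _ + _ = 1 + u); last by rewrite /u; ring.
move=> H; apply: le_trans (H _); last first.
  by move: ud; rewrite ler_norml => /andP[]; lra.
rewrite ler_expR; have : 0 <= b * h ^+ 2 by rewrite mulr_ge0 ?sqr_ge0.
by move: u2; rewrite exprMn /u; lra.
Qed.

End HarmonicProducts.

(** * Eigenvalues of the dual operator and resolvents *)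

Section Duality.
Variables (R : realType) (w : nat -> {posnum R}).
Implicit Types (x : l1 w) (y : linf (inv_weight w)) (z lambda mu : R[i]).

Lemma pairingZr x z y : pairing x (z *: y) = z * pairing x y.
Proof.
have pair0 : pairing x 0 = 0.
  by have := pairing_linearr x (-1) 0 0; rewrite !scaleN1r oppr0 addr0 addNr.
by have := pairing_linearr x z y 0; rewrite pair0 !addr0.
Qed.

Lemma pairingZlB x x' z y :
  pairing (z *: x - x') y = z * pairing x y - pairing x' y.
Proof.
have /= := pairing_linearl y (-1) x' (z *: x).
rewrite [- 1 *: x']scaleN1r [- x' + _]addrC => ->.
rewrite [- 1 *: _]scaleN1r addrC; congr (_ - _).
have pair0 : pairing 0 y = 0.
  by have /= := pairing_linearl y (-1) 0 0; rewrite !scaleN1r oppr0 addr0 addNr.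
by have /= := pairing_linearl y z x 0; rewrite pair0 !addr0.
Qed.

Lemma sup_linf_rangeZ z y : sup (linf_range (inv_weight w) (z *: y)) =
  normc z * sup (linf_range (inv_weight w) y).
Proof.
have := normrZ z y; rewrite !linf_normE normCE -rmorphM /=.
by case.
Qed.

Lemma sup_linf_range_gt0 y : y != 0 ->
  0 < sup (linf_range (inv_weight w) y).
Proof. by rewrite -normr_gt0 linf_normE (ltcRE 0). Qed.

(** A bound [r] for T is also a bound for its dual, which multiplies the norm of [y] by |mu|. *)
Lemma dual_eigenvalue_le (T : {linear l1 w -> l1 w}) r y mu :
  continuous T -> 0 <= r ->
  (forall x, fine (l1_enorm w (T x)) <= r * fine (l1_enorm w x)) ->
  y != 0 -> dual_operator T y = mu *: y -> normc mu <= r.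
Proof.
move=> Tc r0 rT y0 Ty; rewrite -(ler_pM2r (sup_linf_range_gt0 y0)).
rewrite -sup_linf_rangeZ -Ty; apply: linf_norm_le => n.
by rewrite dual_operator_basis//; exact: dual_operator_subproof.
Qed.

(** Pairing e_n = lambda S e_n - T S e_n with [y] and moving T to the other side gives y_n = (lambda
    - mu) <S e_n, y>. *)
Lemma dual_resolvent (T S : {linear l1 w -> l1 w}) lambda mu y :
  continuous T -> continuous S -> cancel S (fun x => lambda *: x - T x) ->
  dual_operator T y = mu *: y -> (lambda - mu) *: dual_operator S y = y.
Proof.
move=> Tc Sc SK Ty; apply/val_inj/funext => n /=.
transitivity (pairing (l1_basis w n) ((lambda - mu) *: dual_operator S y)).
  by rewrite pairing_basis.
rewrite -[RHS]pairing_basis pairingZr dual_operatorP//.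
rewrite -[in RHS](SK (l1_basis w n)) pairingZlB.
by rewrite -(dual_operatorP Tc) Ty pairingZr mulrBl.
Qed.

(** [M] is a bound for [S], independent of [mu], so [mu] may approach [lambda]. The product form
    also covers [mu = lambda], where it is contradictory. *)
Lemma resolvent_dist_eigenvalue (T S : {linear l1 w -> l1 w}) lambda :
  continuous T -> continuous S -> cancel S (fun x => lambda *: x - T x) ->
  exists2 M : R, 0 <= M & forall mu,
    point_spectrum (dual_operator T) mu -> 1 <= M * normc (lambda - mu).
Proof.
move=> Tc Sc SK; have [M M0 SM] := l1_bounded Sc.
exists M => // mu [y y0 Ty]; have Sy := dual_resolvent Tc Sc SK Ty.
have d0 : lambda - mu != 0.
  by apply: contra y0 => /eqP d0; rewrite -Sy d0 scale0r.
have : dual_operator S y = (lambda - mu)^-1 *: y.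
  by rewrite -[in RHS]Sy scalerA mulVf// scale1r.
move=> /(dual_eigenvalue_le Sc M0 SM y0); rewrite normcV.
rewrite -ler_pdivrMr ?div1r// lt_neqAle modc_ge0 andbT eq_sym.
by apply: contra d0 => /eqP/eq0_normc ->.
Qed.

End Duality.

(** * Moduli, and discs as images of half-planes under inversion *)

Section Modulus.
Variable R : realType.
Implicit Types (z : R[i]) (r : R).

Lemma sqr_normc z : normc z ^+ 2 = complex.Re z ^+ 2 + complex.Im z ^+ 2.
Proof. by case: z => a b /=; rewrite sqr_sqrtr// addr_ge0 ?sqr_ge0. Qed.

Lemma normc_gt0 z : (0 < normc z) = (z != 0).
Proof.
rewrite lt_neqAle modc_ge0 andbT eq_sym; congr (~~ _).
by apply/eqP/eqP => [/eq0_normc//|->]; rewrite normc0.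
Qed.

Lemma ReV z : complex.Re z^-1 = complex.Re z / normc z ^+ 2.
Proof. by rewrite sqr_normc; case: z => a b /=. Qed.

Lemma sqr_normc1B z (h : R) :
  normc (1 - z * h%:C) ^+ 2 = 1 - 2 * complex.Re z * h + normc z ^+ 2 * h ^+ 2.
Proof. by rewrite !sqr_normc; case: z => a b /=; ring. Qed.

Lemma sqr_normcB_real z r :
  normc (z - r%:C) ^+ 2 = normc z ^+ 2 - 2 * r * complex.Re z + r ^+ 2.
Proof. by rewrite !sqr_normc; case: z => a b /=; ring. Qed.

Lemma norm_ltcR z r : (`|z| < r%:C) = (normc z < r).
Proof. exact: ltcRE (normc z) r. Qed.

Lemma norm_lecR z r : (`|z| <= r%:C) = (normc z <= r).
Proof. exact: lecRE (normc z) r. Qed.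

Lemma normc_real r : 0 <= r -> normc r%:C = r.
Proof. by move=> r0; rewrite /= expr0n addr0 sqrtr_sqr ger0_norm. Qed.

Lemma disc_lt z r : 0 < r ->
  (`|z - r%:C| < r%:C) = (normc z ^+ 2 < 2 * r * complex.Re z).
Proof.
move=> r0; rewrite norm_ltcR -[LHS]ltr_sqr ?nnegrE ?modc_ge0 ?(ltW r0)// sqr_normcB_real.
by rewrite gtrDr subr_lt0.
Qed.

Lemma disc_le z r : 0 < r ->
  (`|z - r%:C| <= r%:C) = (normc z ^+ 2 <= 2 * r * complex.Re z).
Proof.
move=> r0; rewrite norm_lecR -[LHS]ler_sqr ?nnegrE ?modc_ge0 ?(ltW r0)// sqr_normcB_real.
by rewrite gerDr subr_le0.
Qed.

(** The circle with diameter from 0 to 1/s passes through 0, so inversion turns it into the line Re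
    = s. Discs for lambda thus become conditions on Re(1/lambda). *)
Lemma disc_lt_ReV z (s : R) : 0 < s -> z != 0 ->
  (`|z - ((2 * s)^-1)%:C| < ((2 * s)^-1)%:C) = (s < complex.Re z^-1).
Proof.
move=> s0 z0; rewrite disc_lt ?invr_gt0 ?mulr_gt0// ReV.
rewrite ltr_pdivlMr ?exprn_gt0 ?normc_gt0//.
rewrite (_ : 2 * (2 * s)^-1 = s^-1); last by field; rewrite gt_eqF.
by rewrite -(ltr_pM2l s0) mulVKf ?gt_eqF.
Qed.

Lemma disc_le_ReV z (s : R) : 0 < s -> z != 0 ->
  (`|z - ((2 * s)^-1)%:C| <= ((2 * s)^-1)%:C) = (s <= complex.Re z^-1).
Proof.
move=> s0 z0; rewrite disc_le ?invr_gt0 ?mulr_gt0// ReV.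
rewrite ler_pdivlMr ?exprn_gt0 ?normc_gt0//.
rewrite (_ : 2 * (2 * s)^-1 = s^-1); last by field; rewrite gt_eqF.
by rewrite -(ler_pM2l s0) mulVKf ?gt_eqF.
Qed.

Lemma real_complex_harmonic n : (harmonic n)%:C = n.+1%:R^-1 :> R[i].
Proof. by rewrite /= fmorphV rmorph_nat. Qed.

End Modulus.

(** * The candidate eigenvectors: telescoping sums and growth *)

Section CesaroEigenvectors.
Variable R : realType.
Implicit Types (alpha : R[i]).

(* The solution of [y (n+1) = (1 - alpha/(n+1)) y n], i.e. of [C' y = y/alpha]. *)
Definition dual_eigenseq alpha (n : nat) : R[i]^o :=
  \prod_(k < n) (1 - alpha / k.+1%:R).

Lemma dual_eigenseq0 alpha : dual_eigenseq alpha 0 = 1.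
Proof. by rewrite /dual_eigenseq big_ord0. Qed.

Lemma dual_eigenseqS alpha n :
  dual_eigenseq alpha n.+1 = dual_eigenseq alpha n * (1 - alpha / n.+1%:R).
Proof. by rewrite /dual_eigenseq big_ord_recr. Qed.

(** The sum telescopes: the recurrence reads y_k - y_(k+1) = alpha y_k/(k+1). *)
Lemma sum_dual_eigenseq alpha n N : alpha != 0 -> (n <= N)%N ->
  \sum_(n <= k < N) (k.+1%:R^-1 * dual_eigenseq alpha k : R[i]^o) =
  alpha^-1 *: (dual_eigenseq alpha n - dual_eigenseq alpha N).
Proof.
move=> a0; elim: N => [|N ih].
  by rewrite leqn0 => /eqP ->; rewrite big_geq// subrr scaler0.
rewrite leq_eqVlt => /predU1P[->|]; first by rewrite big_geq// subrr scaler0.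
rewrite ltnS => nN; rewrite big_nat_recr//= ih// dual_eigenseqS.
have E (u v x : R[i]) :
    alpha^-1 * (u - v) + x^-1 * v = alpha^-1 * (u - v * (1 - alpha / x)).
  rewrite [v * _]mulrBr mulr1 opprB addrCA [RHS]mulrDr [LHS]addrC.
  by congr (_ + _); rewrite [RHS]mulrCA mulKf// mulrC.
exact: E.
Qed.

(** Squaring makes the ratio a real quadratic polynomial in 1/(n+1), as the product estimates
    require. *)
Lemma sqr_normc_dual_eigenseqS alpha n :
  normc (dual_eigenseq alpha n.+1) ^+ 2 = normc (dual_eigenseq alpha n) ^+ 2 *
    (1 - 2 * complex.Re alpha * harmonic n + normc alpha ^+ 2 * harmonic2 R n).
Proof.
by rewrite dual_eigenseqS normcM exprMn -real_complex_harmonic sqr_normc1B.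
Qed.

Lemma powR_natN2 n (a : R) :
  n.+1%:R `^ (- (2 * a)) = (n.+1%:R `^ (- a)) ^+ 2 :> R.
Proof. by rewrite !powR_natE expr2 -expRD; congr expR; ring. Qed.

Lemma normc_dual_eigenseq_le alpha : exists2 K, 0 <= K & forall n,
  normc (dual_eigenseq alpha n) <= K * n.+1%:R `^ (- complex.Re alpha).
Proof.
have [|||K K0 qK] := @quadratic_prod_le R
    (fun n => normc (dual_eigenseq alpha n) ^+ 2)
    (complex.Re alpha) (normc alpha ^+ 2).
- exact: sqr_ge0.
- by move=> n; exact: sqr_ge0.
- exact: sqr_normc_dual_eigenseqS.
exists (Num.sqrt K) => [|n]; first exact: sqrtr_ge0.
rewrite -ler_sqr ?nnegrE ?modc_ge0 ?mulr_ge0 ?sqrtr_ge0 ?powR_ge0//.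
by rewrite exprMn sqr_sqrtr// -powR_natN2.
Qed.

(** The hypothesis says exactly that no factor of the product vanishes. *)
Lemma normc_dual_eigenseq_ge alpha : (forall m, alpha != m.+1%:R) ->
  exists2 K, 0 < K & forall n,
  K * n.+1%:R `^ (- complex.Re alpha) <= normc (dual_eigenseq alpha n).
Proof.
move=> alphaN; have q0 n : 0 < normc (dual_eigenseq alpha n).
  rewrite normc_gt0; apply/prodf_neq0 => k _.
  have k0 : k.+1%:R != 0 :> R[i] by rewrite pnatr_eq0.
  apply: contra (alphaN k); rewrite subr_eq0 => /eqP k1.
  by rewrite -(divfK k0 alpha) -k1 mul1r.
have [|||K K0 qK] := @quadratic_prod_ge R
    (fun n => normc (dual_eigenseq alpha n) ^+ 2)
    (complex.Re alpha) (normc alpha ^+ 2).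
- exact: sqr_ge0.
- by move=> n; rewrite exprn_gt0.
- exact: sqr_normc_dual_eigenseqS.
exists (Num.sqrt K) => [|n]; first by rewrite sqrtr_gt0.
rewrite -ler_sqr ?nnegrE ?modc_ge0 ?mulr_ge0 ?sqrtr_ge0 ?powR_ge0//.
by rewrite exprMn sqr_sqrtr ?(ltW K0)// -powR_natN2.
Qed.

Lemma cvg_powR_nat0 (a : R) : 0 < a -> n.+1%:R `^ (- a) @[n --> \oo] --> (0 : R).
Proof.
move=> a0; apply/cvgrPdist_lt => e e0.
(* The threshold solves x^(-a) = e for x. *)
exists (Num.truncn (expR (- (ln e / a)))) => // n /= Nn.
rewrite sub0r normrN ger0_norm ?powR_ge0// powR_natE -[e]lnK ?posrE// ltr_expR.
rewrite mulNr -ltrN2 opprK mulrC -ltr_pdivrMr// -[ltLHS]expRK mulNr.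
rewrite ltr_ln ?posrE ?expR_gt0 ?ltr0n//.
by apply: lt_le_trans (truncnS_gt _) _; rewrite ler_nat.
Qed.

Lemma cvg_normc0 (u : nat -> R[i]^o) (v : nat -> R) :
  (forall n, normc (u n) <= v n) -> v @ \oo --> (0 : R) ->
  u @ \oo --> (0 : R[i]^o).
Proof.
move=> uv /cvgrPdist_lt v0; apply/cvgrPdist_lt => e /gt0_complexE[r r0 ->].
have := v0 r r0; apply: filterS => n.
rewrite !sub0r !normrN normCE ltcRE => /(le_lt_trans _); apply.
by rewrite (le_trans (uv n))// ler_norm.
Qed.

Lemma cvg_scale_sub0 (a c : R[i]) (u : nat -> R[i]^o) :
  u @ \oo --> (0 : R[i]^o) ->
  (a *: (c - u n) : R[i]^o) @[n --> \oo] --> (a *: c : R[i]^o).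
Proof.
move=> u0; have uc : (fun n => (c : R[i]^o) - u n) @ \oo --> (c - 0 : R[i]^o).
  by apply: cvgB; [exact: cvg_cst|exact: u0].
rewrite subr0 in uc; exact: (cvgZl_tmp (k := a) uc).
Qed.

Lemma dual_eigenseq_cvg0 alpha : 0 < complex.Re alpha ->
  dual_eigenseq alpha @ \oo --> (0 : R[i]^o).
Proof.
move=> a0; have [K K0 yK] := normc_dual_eigenseq_le alpha.
apply: (cvg_normc0 yK); rewrite -[X in _ --> X](mulr0 K).
by apply: cvgMr; exact: cvg_powR_nat0.
Qed.

Lemma dual_eigenseq_nat m n : (m < n)%N -> dual_eigenseq m.+1%:R n = 0.
Proof.
move=> mn; rewrite /dual_eigenseq (bigD1 (Ordinal mn))//=.
by rewrite divff ?pnatr_eq0// subrr mul0r.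
Qed.

(** In this form, [S1 w s] says that the sequence n^(-s) lies in l_infty(w^-1), ready for comparison
    with eigenvectors of size n^(-Re alpha). *)
Lemma S1P (w : nat -> {posnum R}) s : S1 w s <->
  exists D, forall n, n.+1%:R `^ (- s) <= D * (w n)%:num.
Proof.
split=> -[D sD]; exists D.
  move=> n; have /sD : range (fun n => (n.+1%:R `^ s * (w n)%:num)^-1)
    (n.+1%:R `^ s * (w n)%:num)^-1 by exists n.
  by rewrite invfM -powRN ler_pdivrMr.
by move=> _ [n _ <-]; rewrite invfM -powRN ler_pdivrMr.
Qed.

End CesaroEigenvectors.

(** * Point spectrum of the dual Cesàro operator, and the spectrum *)

Section CesaroDual.
Variables (R : realType) (w : nat -> {posnum R}) (C : {linear l1 w -> l1 w}).
Hypothesis C_cesaro : forall x : l1 w, l1_val (C x) = cesaro_operator (l1_val x).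
Hypothesis C_continuous : continuous C.
Implicit Types (y : linf (inv_weight w)) (alpha lambda mu : R[i]).

Lemma cesaro_basis n k : C (l1_basis w n) k = (n <= k)%:R / k.+1%:R.
Proof.
rewrite C_cesaro /cesaro_operator /=; congr (_ / _).
have [nk|kn] := leqP n k.
  rewrite (bigD1 (Ordinal (nk : (n < k.+1)%N)))//= eqxx big1 ?addr0// => j.
  by rewrite -val_eqE /= => /negbTE ->.
rewrite big1// => j _; rewrite ltn_eqF//.
by apply: leq_trans kn; exact: ltn_ord.
Qed.

(** Both images are tails of the harmonic sequence and differ only in entry [n]. Dually, this is a
    recurrence for C'y that needs no infinite sum. *)
Lemma cesaro_basisS n :
  C (l1_basis w n) = n.+1%:R^-1 *: l1_basis w n + C (l1_basis w n.+1).
Proof.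
apply/val_inj/funext => k /=.
rewrite -[RHS]/(n.+1%:R^-1 * (k == n)%:R + C (l1_basis w n.+1) k).
rewrite !cesaro_basis; have [nk|nk|->] := ltngtP n k.
- by rewrite mulr0 add0r.
- by rewrite mulr0 add0r.
- by rewrite mulr1 mul0r addr0 mul1r.
Qed.

Lemma dual_cesaroS y n : dual_operator C y n =
  n.+1%:R^-1 * y n + dual_operator C y n.+1 :> R[i].
Proof.
rewrite !dual_operator_basis// {1}cesaro_basisS -[y n in RHS]pairing_basis.
exact: pairing_linearl.
Qed.

Lemma dual_cesaro_eigenvector y lambda : lambda != 0 ->
  dual_operator C y = lambda *: y ->
  forall n, y n = y 0 * dual_eigenseq lambda^-1 n.
Proof.
move=> l0 Cy; elim=> [|n ih]; first by rewrite dual_eigenseq0 mulr1.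
rewrite dual_eigenseqS mulrA -ih.
have := dual_cesaroS y n; rewrite Cy -[(_ *: y) n]/(lambda * y n).
rewrite -[(_ *: y) n.+1]/(lambda * y n.+1) => /(congr1 ( *%R lambda^-1)).
rewrite mulrDr !mulKf// => yn; rewrite mulrBr mulr1 {1}yn.
by rewrite [y n * _]mulrC -[lambda^-1 / _ * y n]mulrA addrAC subrr add0r.
Qed.

(** Entry n of C'y is the sum of y_k/(k+1) over k >= n. Its partial sums telescope to (y_n -
    y_N)/alpha, and y_N tends to 0. *)
Lemma dual_cesaro_eigenseq alpha y : alpha != 0 ->
  (forall n, y n = dual_eigenseq alpha n) ->
  dual_eigenseq alpha @ \oo --> (0 : R[i]^o) ->
  dual_operator C y = alpha^-1 *: y.
Proof.
move=> a0 yE y_cvg0; apply/val_inj/funext => n /=.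
rewrite [LHS]dual_operator_basis//.
have h := @pairing_cvg R w (C (l1_basis w n)) y.
apply: (@cvg_unique R[i]^o (@norm_hausdorff _ R[i]^o) _ _ _ _ h).
apply: cvg_trans (@cvg_scale_sub0 R alpha^-1 (y n) _ y_cvg0).
apply: near_eq_cvg; exists n => // N /= nN.
rewrite yE -sum_dual_eigenseq//.
rewrite /series /= [RHS](big_cat_nat (n := n))//=.
rewrite [X in X + _]big1_seq ?add0r.
  apply: eq_big_nat => k /andP[nk _].
  by rewrite cesaro_basis nk div1r yE.
move=> k /andP[_]; rewrite mem_index_iota => /andP[_ kn].
by rewrite cesaro_basis leqNgt kn !mul0r.
Qed.

Lemma point_spectrum_dual_cesaro alpha : alpha != 0 ->
  dual_eigenseq alpha \in linf_pred (inv_weight w) ->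
  dual_eigenseq alpha @ \oo --> (0 : R[i]^o) ->
  point_spectrum (dual_operator C) alpha^-1.
Proof.
move=> a0 yP y_cvg0; exists (Linf yP); last exact: dual_cesaro_eigenseq.
apply/eqP => /(congr1 (fun z => linf_val z 0)) /= /eqP.
by rewrite dual_eigenseq0 -[X in _ == X]/(0 : R[i]) oner_eq0.
Qed.

Lemma dual_eigenseq_linf alpha s : S1 w s -> s <= complex.Re alpha ->
  dual_eigenseq alpha \in linf_pred (inv_weight w).
Proof.
move=> /S1P[D sD] sa; have [K K0 yK] := normc_dual_eigenseq_le alpha.
rewrite inE; exists (K * D) => _ [n _ <-] /=; rewrite ler_pdivrMl//.
apply: le_trans (yK n) _; rewrite [leRHS]mulrC -mulrA.
rewrite ler_wpM2l//; apply: le_trans (sD n).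
by rewrite ler_powR ?ler1n// lerN2.
Qed.

(** Comparison with [s] puts the eigenvector in the space, and positivity of Re alpha makes it tend
    to 0. The sign of [s] is left free because this lemma serves to prove that [S1 w] has a positive
    lower bound. *)
Lemma point_spectrum_dual_cesaro_S1 alpha s :
  S1 w s -> s <= complex.Re alpha -> 0 < complex.Re alpha ->
  point_spectrum (dual_operator C) alpha^-1.
Proof.
move=> Ss sa a0; apply: point_spectrum_dual_cesaro.
- by apply: contraTneq a0 => ->; rewrite ltxx.
- exact: dual_eigenseq_linf Ss sa.
- exact: dual_eigenseq_cvg0.
Qed.

Lemma reciprocals_point_spectrum :
  reciprocals R `<=` point_spectrum (dual_operator C).
Proof.
move=> _ [m _ <-]; apply: point_spectrum_dual_cesaro.
- by rewrite pnatr_eq0.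
- rewrite inE; pose t n := (inv_weight w n)%:num * normc (dual_eigenseq m.+1%:R n).
  have t0 n : 0 <= t n by rewrite mulr_ge0 ?modc_ge0.
  (* The support lies in the indices up to [m], so the sum of these nonnegative terms bounds each of
     them. *)
  exists (\sum_(k < m.+1) t k) => _ [n _ <-]; rewrite -/(t n).
  have [nm|mn] := ltnP n m.+1.
    by rewrite (bigD1 (Ordinal nm))//= lerDl sumr_ge0.
  rewrite [t n](_ : _ = 0) ?sumr_ge0//.
  by rewrite /t (dual_eigenseq_nat _ mn) [normc _](normc0 R) mulr0.
- apply: cvg_near_cst; exists m.+1 => // n /= mn.
  exact: dual_eigenseq_nat.
Qed.

(* [1/t] is an eigenvalue of the dual operator as soon as [t > 0] exceeds an
   element of [S1 w], and eigenvalues are bounded by the operator norm. *)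
Lemma S1_pos_lbound : exists2 b, 0 < b & lbound (S1 w) b.
Proof.
have [r r0 rC] := l1_bounded C_continuous.
have r1 : 0 < r + 1 by rewrite ltr_wpDl.
exists (r + 1)^-1 => [|s Ss]; first by rewrite invr_gt0.
rewrite leNgt; apply/negP => sr.
(* The maximum keeps [t] positive even if [s] is not, and below 1/(r + 1), so the eigenvalue 1/t
   exceeds [r]. *)
pose t := Num.max s ((r + 1)^-1 / 2).
have t0 : 0 < t by rewrite lt_max divr_gt0 ?invr_gt0// orbT.
have tr : t < (r + 1)^-1.
  by rewrite gt_max sr ltr_pdivrMr// ltr_pMr ?invr_gt0// ltr1n.
have [||y y0 Cy] := @point_spectrum_dual_cesaro_S1 t%:C s Ss.
- by rewrite /= le_max lexx.
- by [].
have := dual_eigenvalue_le C_continuous r0 rC y0 Cy.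
rewrite normcV normc_real ?(ltW t0)//; apply/negP; rewrite -ltNge.
apply: (@lt_trans _ _ (r + 1)); first by rewrite ltrDl.
by rewrite -[ltLHS]invrK ltf_pV2 ?posrE ?invr_gt0.
Qed.

(** An eigenvector is y_0 times [dual_eigenseq] with y_0 nonzero. Its lower bound n^(-Re(1/lambda)),
    up to a constant, is thus dominated by |y_n|, hence by w(n) times the norm of y. *)
Lemma eigenvalue_dual_cesaro_S1 lambda : lambda != 0 -> ~ reciprocals R lambda ->
  point_spectrum (dual_operator C) lambda -> S1 w (complex.Re lambda^-1).
Proof.
move=> l0 lN [y y0 Cy]; have yE := dual_cesaro_eigenvector l0 Cy.
have [|K K0 yK] := @normc_dual_eigenseq_ge R lambda^-1.
  move=> m; apply/eqP => lm; apply: lN; exists m => //.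
  by rewrite -lm invrK.
have y00 : 0 < normc (y 0).
  rewrite normc_gt0; apply: contra y0 => /eqP y00.
  by apply/eqP/val_inj/funext => n /=; rewrite yE y00 mul0r.
apply/S1P; exists (sup (linf_range (inv_weight w) y) / (K * normc (y 0))) => n.
have yn : normc (y n) <= (w n)%:num * sup (linf_range (inv_weight w) y).
  by have := linf_term y n; rewrite /= ler_pdivrMl.
rewrite mulrAC ler_pdivlMr ?mulr_gt0// [leRHS]mulrC; apply: le_trans yn.
rewrite (yE n) normcM [leRHS]mulrC mulrA ler_wpM2r ?modc_ge0//.
by rewrite mulrC.
Qed.

Lemma closed_disc_spectrum (T : {linear l1 w -> l1 w}) (r : R) :
  continuous T -> 0 < r ->
  [set z | `|z - r%:C| < r%:C] `<=` point_spectrum (dual_operator T) ->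
  [set z | `|z - r%:C| <= r%:C] `<=` spectrum T.
Proof.
move=> Tc r0 rT z /=; rewrite norm_lecR => zr [S [Sc _ SK]].
have [M M0 MT] := resolvent_dist_eigenvalue Tc Sc SK.
have Mr : 0 < 1 + M * r by rewrite ltr_pwDl// mulr_ge0// ltW.
(* Moving [z] towards the centre by the fraction [t] lands in the open disc, at distance at most t r
   from [z], and M t r < 1 contradicts the resolvent bound. *)
pose t := (1 + M * r)^-1; have t0 : 0 < t by rewrite invr_gt0.
have t1 : t <= 1 by rewrite invf_le1// lerDl mulr_ge0// ltW.
pose mu := z - t%:C * (z - r%:C).
have /MT : point_spectrum (dual_operator T) mu.
  apply: rT => /=; rewrite norm_ltcR.
  rewrite (_ : mu - _ = (1 - t)%:C * (z - r%:C)); last first.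
    by rewrite /mu rmorphB rmorph1; ring.
  rewrite normcM normc_real ?subr_ge0//.
  apply: le_lt_trans (ler_wpM2l _ zr) _; first by rewrite subr_ge0.
  by rewrite gtr_pMl// gtrBl.
apply/negP; rewrite -ltNge /mu subKr normcM normc_real ?(ltW t0)//.
rewrite mulrCA ltr_pdivrMl// mulr1.
by apply: le_lt_trans (ler_wpM2l M0 zr) _; rewrite ltrDr.
Qed.

Lemma point_spectrum_dual_spectrum (T : {linear l1 w -> l1 w}) :
  continuous T -> point_spectrum (dual_operator T) `<=` spectrum T.
Proof.
move=> Tc z Tz [S [Sc _ SK]].
have [M M0 /(_ _ Tz)] := resolvent_dist_eigenvalue Tc Sc SK.
by rewrite subrr normc0 mulr0 ler10.
Qed.

End CesaroDual.

Theorem proposition3p9 (R : realType) (w : nat -> {posnum R})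
    (w_bounded : bounded_fun (fun n => (w n)%:num))
    (C : {linear l1 w -> l1 w})
    (C_cesaro : forall x : l1 w, l1_val (C x) = cesaro_operator (l1_val x))
    (C_continuous : continuous C)
    (S1_nonempty : S1 w !=set0) :
  0 < s1 w /\
  let r : R[i] := ((2 * s1 w)^-1)%:C in
  [/\ [set z : R[i] | `|z - r| < r] `|` reciprocals R
        `<=` point_spectrum (dual_operator C),
      point_spectrum (dual_operator C) `\` reciprocals R
        `<=` [set z : R[i] | `|z - r| <= r] &
      [set z : R[i] | `|z - r| <= r] `|` reciprocals R `<=` spectrum C].
Proof.
have [b b0 S1b] := S1_pos_lbound C_cesaro C_continuous.
have s0 : 0 < s1 w by apply: lt_le_trans b0 _; exact: lb_le_inf.
have r0 : 0 < (2 * s1 w)^-1 by rewrite invr_gt0 mulr_gt0.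
split=> //=.
have disc : [set z : R[i] | `|z - ((2 * s1 w)^-1)%:C| < ((2 * s1 w)^-1)%:C]
    `<=` point_spectrum (dual_operator C).
  (* The point 0 lies on the bounding circle, hence outside the open disc, and 1/z makes sense. *)
  move=> z /= zr; have z0 : z != 0.
    apply: contraTneq zr => ->; rewrite disc_lt//= mulr0 -leNgt.
    by rewrite exprn_ge0// modc_ge0.
  move: zr; rewrite disc_lt_ReV// => sz.
  have [s Ss sz'] := inf_lt S1_nonempty sz.
  rewrite -[z]invrK; apply: point_spectrum_dual_cesaro_S1 Ss (ltW sz') _ => //.
  exact: lt_trans sz.
have recip := reciprocals_point_spectrum C_cesaro C_continuous.
split.
- by rewrite subUset.
(* The inversion criterion excludes 0, which belongs to the closed disc anyway. *)
- move=> z [Cz zN] /=; have [->|z0] := eqVneq z 0.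
    by rewrite disc_le// [normc _](normc0 R) mulr0 expr0n.
  rewrite disc_le_ReV//; apply: ge_inf; first by exists b.
  exact: eigenvalue_dual_cesaro_S1 Cz.
- rewrite subUset; split; first exact: closed_disc_spectrum.
  exact: subset_trans recip (point_spectrum_dual_spectrum C_continuous).
Qed.
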